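(* Let $\mathcal{S}_\tau$ be an admissible supercritical regime (in density-energy coordinates) and set $\mathcal{S}_U=\Theta(\mathcal{S}_\tau\times\mathbb{R})$. If there exists a conservative numerical scheme $$h\frac{d\boldsymbol{U}_C}{dt}+\boldsymbol{f}_h(\boldsymbol{U}_R,\boldsymbol{U}_C)-\boldsymbol{f}_h(\boldsymbol{U}_C,\boldsymbol{U}_L)=0$$ with a consistent numerical flux $\boldsymbol{f}_h:\mathcal{S}_U\times\mathcal{S}_U\to\mathbb{R}^3$ that is pressure-equilibrium-preserving (PEP), then for every $P\in\mathbb{R}_+$ such that the isobar $\Gamma_P$ is nonempty and all $\boldsymbol{\tau}_1,\boldsymbol{\tau}_2\in\Gamma_P$ one has $L_{\boldsymbol{\tau}_1}\Gamma_P\cap L_{\boldsymbol{\tau}_2}\Gamma_P\neq\varnothing$.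
   Context: **Equation of state.** Fix $\sigma_{\min}\in\mathbb{R}$ and let $\mathcal{T}=\{(\nu,\sigma)\in\mathbb{R}^2:\nu>0,\ \sigma\ge\sigma_{\min}\}$. An equation of state is a function $e:\mathcal{T}\to\mathbb{R}$ that is $C^1$ and piecewise twice continuously differentiable. Subscripts denote partial derivatives. Pressure and temperature in $(\nu,\sigma)$-coordinates are $\hat p:=-e_\nu$ and $T:=e_\sigma$. $\mathbb{R}_+$ denotes the positive reals. **Admissible supercritical regime.** A nonempty set $\mathcal{S}_\eta\subset\operatorname{int}(\mathcal{T})$, open in $\mathbb{R}^2$, is an admissible supercritical regime if: (1) $e\in C^2(\mathcal{S}_\eta)$; (2) $\hat p>0$ and $T>0$ on $\mathcal{S}_\eta$, and for each fixed $\nu$ the map $\sigma\mapsto e(\nu,\sigma)$ is injective on $\{\sigma:(\nu,\sigma)\in\mathcal{S}_\eta\}$; (3) $e_{\nu\nu}>0$, $e_{\sigma\sigma}>0$ and $e_{\nu\nu}e_{\sigma\sigma}>(e_{\nu\sigma})^2$ on $\mathcal{S}_\eta$. **Density-energy coordinates.** $\Phi:\mathcal{S}_\eta\to\mathbb{R}^2$, $\Phi(\nu,\sigma)=(1/\nu,\ e(\nu,\sigma)/\nu)=:(\rho,\varepsilon)$, is a $C^2$ diffeomorphism onto its image $\mathcal{S}_\tau:=\Phi(\mathcal{S}_\eta)$, which is called an admissible supercritical regime in density-energy coordinates; its points are $\boldsymbol{\tau}=(\rho,\varepsilon)$. The pressure on $\mathcal{S}_\tau$ is $p(\boldsymbol{\tau}):=\hat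 p(\Phi^{-1}(\boldsymbol{\tau}))$; it is $C^1$ with nowhere vanishing gradient. **Isobars and tangent lines.** For $P\in\mathbb{R}_+$, $\Gamma_P:=\{\boldsymbol{\tau}\in\mathcal{S}_\tau:p(\boldsymbol{\tau})=P\}$. Near each of its points $\Gamma_P$ has a regular local $C^1$ parameterization $\varphi:I\to\Gamma_P$ ($I$ an open interval, $\varphi'\ne 0$). For $\boldsymbol{\tau}=\varphi(t)\in\Gamma_P$, the tangent space is $T_{\boldsymbol{\tau}}\Gamma_P:=\operatorname{span}(\varphi'(t))\subset\mathbb{R}^2$ (independent of $\varphi$), and the tangent line is $L_{\boldsymbol{\tau}}\Gamma_P:=\boldsymbol{\tau}+T_{\boldsymbol{\tau}}\Gamma_P$. **Conservative variables.** $\Theta:\mathcal{S}_\tau\times\mathbb{R}\to\mathbb{R}^3$, $\Theta((\rho,\varepsilon),v)=(\rho,\ \rho v,\ \varepsilon+\tfrac12\rho v^2)$, and $\mathcal{S}_U:=\Theta(\mathcal{S}_\tau\times\mathbb{R})$, an open set with points $\boldsymbol{U}=(\rho,m,E)$. Put $v(\boldsymbol{U})=m/\rho$, $\varepsilon(\boldsymbol{U})=E-\tfrac12 m^2/\rho$, $\boldsymbol{\tau}(\boldsymbol{U})=(\rho,\varepsilon(\boldsymbol{U}))$. The Euler flux is $\boldsymbol{f}(\boldsymbol{U})=(\rho v,\ \rho v^2+p,\ v(E+p))$ with $v=v(\boldsymbol{U})$, $p=p(\boldsymbol{\tau}(\boldsymbol{U}))$. For $P\in\mathbb{R}_+$,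 $V\in\mathbb{R}$ let $\mathcal{M}_{P,V}:=\{\boldsymbol{U}\in\mathcal{S}_U:p(\boldsymbol{\tau}(\boldsymbol{U}))=P,\ v(\boldsymbol{U})=V\}$. **Schemes.** A numerical flux is any function $\boldsymbol{f}_h:\mathcal{S}_U\times\mathcal{S}_U\to\mathbb{R}^3$; it is consistent if $\boldsymbol{f}_h(\boldsymbol{U},\boldsymbol{U})=\boldsymbol{f}(\boldsymbol{U})$ for all $\boldsymbol{U}\in\mathcal{S}_U$. On a one-dimensional grid of cells of size $h>0$ (with at least one interior cell), a conservative spatial discretization with flux $\boldsymbol{f}_h$ imposes the displayed ODE in every interior cell, where $\boldsymbol{U}_C\in\mathcal{S}_U$ is the grid value in the cell and $\boldsymbol{U}_L,\boldsymbol{U}_R\in\mathcal{S}_U$ are the values in the left and right neighboring cells. It is a numerical scheme if for any admissible initial grid state (any assignment of values in $\mathcal{S}_U$ to the cells) the resulting ODE system admits a local classical solution, i.e. a continuously differentiable solution, on some time interval starting at and including the initial time, satisfying the ODEs pointwise. Such a scheme with consistent flux is pressure-equilibrium-preserving (PEP) if for any admissible initial conditions, any time $t$ for which the scheme is defined, any interior cell, and any $P\in\mathbb{R}_+$, $V\in\mathbb{R}$: $$\boldsymbol{U}_R(t),\boldsymbol{U}_C(t),\boldsymbol{U}_L(t)\in\mathcal{M}_{P,V}\ \Longrightarrow\ \frac{d}{dt}p(\boldsymbol{\tau}(\boldsymbol{U}_C))=0,\quad \frac{d}{dt}v(\boldsymbol{U}_C)=0\ \text{ at time } t.$$ *)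

(* Defs.v *)
From Stdlib Require Export Reals ClassicalEpsilon.
From Coquelicot Require Export Coquelicot.
Open Scope R_scope.

(* States (rho, m, E) are left-nested pairs ((rho, m), E). *)
Definition R3 : Type := (R * R * R)%type.

(* Derivative at [t] of [f] relative to [J]: the difference quotient is taken
   along points of [J] only, so it is one-sided at an endpoint of an
   interval. *)
Definition is_derive_within {V : NormedModule R_AbsRing}
    (J : R -> Prop) (f : R -> V) (t : R) (l : V) : Prop :=
  filterdiff f (within J (locally t)) (fun dt : R => scal dt l).

Definition closure {X : UniformSpace} (A : X -> Prop) (x : X) : Prop :=
  forall N : X -> Prop, locally x N -> exists y, N y /\ A y.

(* Throughout, [e] is a total function; only its values on [eos_domain smin]
   are ever constrained. *)
Definition eos_domain (smin : R) : R * R -> Prop :=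
  fun x => 0 < fst x /\ smin <= snd x.

(* The domain contains its edge sigma = smin, where the sigma-derivative is
   one-sided; continuity of the partial derivatives is relative to [A]. *)
Definition C1_on (A : R * R -> Prop) (e : R -> R -> R) : Prop :=
  exists e1 e2 : R * R -> R,
    (forall nu sigma, A (nu, sigma) ->
       is_derive_within (fun u => A (u, sigma)) (fun u => e u sigma) nu
         (e1 (nu, sigma)) /\
       is_derive_within (fun u => A (nu, u)) (fun u => e nu u) sigma
         (e2 (nu, sigma))) /\
    continuous_on A e1 /\ continuous_on A e2.

(* [A] is subdivided by a locally finite family of disjoint open pieces (some
   possibly empty) whose closures cover it; on each piece [e] is C^2 and its
   second partial derivatives extend continuously to the closure of the piece
   in [A]. *)
Definition piecewise_C2_on (A : R * R -> Prop) (e : R -> R -> R) : Prop :=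
  exists K : nat -> R * R -> Prop,
    (forall i, open (K i)) /\
    (forall i x, K i x -> A x) /\
    (forall i j x, K i x -> K j x -> i = j) /\
    (forall x, A x -> exists i, closure (K i) x) /\
    (forall x, A x ->
       exists m : nat, locally x (fun y => forall i, (m <= i)%nat -> ~ K i y)) /\
    (forall i nu sigma, K i (nu, sigma) -> ex_diff_n e 2 nu sigma) /\
    (forall i j k, (j + k = 2)%nat ->
       exists g : R * R -> R,
         continuous_on (fun x => A x /\ closure (K i) x) g /\
         (forall nu sigma, K i (nu, sigma) ->
            g (nu, sigma) = partial_derive j k e nu sigma)).

Definition equation_of_state (smin : R) (e : R -> R -> R) : Prop :=
  C1_on (eos_domain smin) e /\ piecewise_C2_on (eos_domain smin) e.

Definition p_hat (e : R -> R -> R) (nu sigma : R) : R :=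
  - partial_derive 1 0 e nu sigma.

Definition temperature (e : R -> R -> R) (nu sigma : R) : R :=
  partial_derive 0 1 e nu sigma.

Record admissible_regime (smin : R) (e : R -> R -> R) (S : R * R -> Prop)
    : Prop := {
  regime_nonempty : exists x, S x;
  regime_interior : forall x, S x -> locally x (eos_domain smin);
  regime_open : open S;
  regime_C2 : forall nu sigma, S (nu, sigma) -> ex_diff_n e 2 nu sigma;
  regime_pressure_pos : forall nu sigma, S (nu, sigma) -> 0 < p_hat e nu sigma;
  regime_temperature_pos :
    forall nu sigma, S (nu, sigma) -> 0 < temperature e nu sigma;
  regime_injective : forall nu sigma1 sigma2,
    S (nu, sigma1) -> S (nu, sigma2) -> e nu sigma1 = e nu sigma2 ->
    sigma1 = sigma2;
  regime_convex : forall nu sigma, S (nu, sigma) ->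
    0 < partial_derive 2 0 e nu sigma /\
    0 < partial_derive 0 2 e nu sigma /\
    (partial_derive 1 1 e nu sigma) ^ 2
      < partial_derive 2 0 e nu sigma * partial_derive 0 2 e nu sigma
}.

Definition Phi (e : R -> R -> R) (x : R * R) : R * R :=
  (1 / fst x, e (fst x) (snd x) / fst x).

Definition S_tau (e : R -> R -> R) (S : R * R -> Prop) (tau : R * R) : Prop :=
  exists x, S x /\ Phi e x = tau.

(* On [S_tau e S] this is the inverse of the restriction of [Phi e] to [S];
   elsewhere the value is unspecified. *)
Definition Phi_inv (e : R -> R -> R) (S : R * R -> Prop) (tau : R * R) : R * R :=
  epsilon (inhabits (0, 0)) (fun x => S x /\ Phi e x = tau).

Definition pressure (e : R -> R -> R) (S : R * R -> Prop) (tau : R * R) : R :=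
  p_hat e (fst (Phi_inv e S tau)) (snd (Phi_inv e S tau)).

Definition isobar (e : R -> R -> R) (S : R * R -> Prop) (P : R) (tau : R * R)
    : Prop :=
  S_tau e S tau /\ pressure e S tau = P.

(* [phi] with derivative [dphi] is a regular C^1 parameterization, defined on
   the open interval ]a, b[, of the set [G] near [phi t]. *)
Definition regular_parameterization (G : R * R -> Prop) (a b : Rbar)
    (phi dphi : R -> R * R) (t : R) : Prop :=
  Rbar_lt a t /\ Rbar_lt t b /\
  (forall s : R, Rbar_lt a s -> Rbar_lt s b ->
     G (phi s) /\ is_derive phi s (dphi s) /\ continuous dphi s /\
     dphi s <> (0, 0)) /\
  locally (phi t)
    (fun y => G y -> exists s : R, Rbar_lt a s /\ Rbar_lt s b /\ phi s = y).

Definition tangent_space (G : R * R -> Prop) (tau w : R * R) : Prop :=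
  exists (a b : Rbar) (phi dphi : R -> R * R) (t : R),
    regular_parameterization G a b phi dphi t /\ phi t = tau /\
    exists c : R, w = scal c (dphi t).

Definition tangent_line (G : R * R -> Prop) (tau x : R * R) : Prop :=
  exists w, tangent_space G tau w /\ x = plus tau w.

Definition Theta (tau : R * R) (v : R) : R3 :=
  let (rho, eps) := tau in (rho, rho * v, eps + / 2 * rho * v ^ 2).

Definition S_U (e : R -> R -> R) (S : R * R -> Prop) (U : R3) : Prop :=
  exists tau v, S_tau e S tau /\ Theta tau v = U.

Definition velocity (U : R3) : R :=
  let '(rho, m, E) := U in m / rho.

Definition tau_of (U : R3) : R * R :=
  let '(rho, m, E) := U in (rho, E - / 2 * m ^ 2 / rho).

Definition euler_flux (e : R -> R -> R) (S : R * R -> Prop) (U : R3) : R3 :=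
  let '(rho, m, E) := U in
  let v := velocity U in
  let p := pressure e S (tau_of U) in
  (rho * v, rho * v ^ 2 + p, v * (E + p)).

Definition M_PV (e : R -> R -> R) (S : R * R -> Prop) (P V : R) (U : R3) : Prop :=
  S_U e S U /\ pressure e S (tau_of U) = P /\ velocity U = V.

(* Only the values of a numerical flux [fh] on pairs of points of [S_U] are ever
   used. *)
Definition consistent (e : R -> R -> R) (S : R * R -> Prop)
    (fh : R3 -> R3 -> R3) : Prop :=
  forall U, S_U e S U -> fh U U = euler_flux e S U.

(* The grid has cells 0, ..., n+1, of which 1, ..., n are interior. *)
Definition admissible_grid_state (e : R -> R -> R) (S : R * R -> Prop)
    (n : nat) (u : nat -> R3) : Prop :=
  forall i, (i <= n + 1)%nat -> S_U e S (u i).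

Definition interior_cell (n i : nat) : Prop := (1 <= i <= n)%nat.

(* A nondegenerate interval, of any kind, containing its left endpoint 0. *)
Definition time_interval (J : R -> Prop) : Prop :=
  J 0 /\ (forall t, J t -> 0 <= t) /\ (exists t, 0 < t /\ J t) /\
  (forall s t, J t -> 0 <= s <= t -> J s).

(* Classical solution on [J]; no equation is imposed in the two boundary
   cells. *)
Definition solution (e : R -> R -> R) (S : R * R -> Prop) (n : nat) (h : R)
    (fh : R3 -> R3 -> R3) (J : R -> Prop) (u0 : nat -> R3)
    (U : nat -> R -> R3) : Prop :=
  (forall i, (i <= n + 1)%nat -> U i 0 = u0 i) /\
  (forall t, J t -> admissible_grid_state e S n (fun i => U i t)) /\
  exists dU : nat -> R -> R3,
    (forall i, (i <= n + 1)%nat ->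
       (forall t, J t -> is_derive_within J (U i) t (dU i t)) /\
       continuous_on J (dU i)) /\
    (forall i t, interior_cell n i -> J t ->
       plus (scal h (dU i t))
            (minus (fh (U (i + 1)%nat t) (U i t))
                   (fh (U i t) (U (i - 1)%nat t))) = zero).

Definition numerical_scheme (e : R -> R -> R) (S : R * R -> Prop) (n : nat)
    (h : R) (fh : R3 -> R3 -> R3) : Prop :=
  forall u0, admissible_grid_state e S n u0 ->
    exists J U, time_interval J /\ solution e S n h fh J u0 U.

Definition pressure_equilibrium_preserving (e : R -> R -> R)
    (S : R * R -> Prop) (n : nat) (h : R) (fh : R3 -> R3 -> R3) : Prop :=
  forall u0 J U, admissible_grid_state e S n u0 -> time_interval J ->
    solution e S n h fh J u0 U ->
    forall t i P V, J t -> interior_cell n i -> 0 < P ->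
      M_PV e S P V (U (i + 1)%nat t) ->
      M_PV e S P V (U i t) ->
      M_PV e S P V (U (i - 1)%nat t) ->
      is_derive_within J (fun s => pressure e S (tau_of (U i s))) t 0 /\
      is_derive_within J (fun s => velocity (U i s)) t 0.

(* Main.v *)
Require Import Defs.
From Stdlib Require Import Lra Lia.

(** Fix the speed 1 and, for two points tau1, tau2 of one isobar, let G be the
    numerical flux evaluated at the states [Theta tau1 1] and [Theta tau2 1].  Two sets
    of three neighbouring states are in pressure equilibrium and involve G:
    (left, centre, right) = (tau2, tau1, tau1) and (tau2, tau2, tau1).  By consistency
    the rate of change of the central state, multiplied by - h, is f(tau1) - G in the first
    case and G - f(tau2) in the second.  As the pressure of the central cell is
    stationary, the velocity at which its density-energy pair starts to move is tangent
    to the isobar ([flux_difference_tangent]).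

    At speed v, this velocity is the image of the rate of change of (rho, m, E) under the
    linear map [dtau_of v], the differential of U |-> (rho, E - m^2 / (2 rho)).  On fluxes
    of equilibrium states this map takes the value v * tau, the pressure terms
    cancelling ([dtau_of_flux]).  So with v = 1 and x = dtau_of 1 G, the two facts above
    read: tau1 - x is tangent at tau1 and x - tau2 is tangent at tau2.  Hence x lies on
    both tangent lines.

    The analytic content is that a path of density-energy pairs along which the pressure
    is stationary has a velocity in [tangent_space] ([isobaric_velocity_tangent]).  It is
    obtained in the coordinates (nu, sigma).  Since e_nu_nu > 0, the implicit function
    theorem writes the level sets of - e_nu as graphs nu = g(sigma), and
    s |-> Phi (g s, s) is a regular parameterization of the isobar; it covers a
    neighbourhood because [Phi_inv] is continuous, which follows from e_sigma > 0 and
    the injectivity of e in sigma ([isobar_regular_parameterization]).  The path is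
    pulled back by [Phi_inv], its sigma component being differentiable as the solution
    of e(nu, sigma) = eps / rho ([slope_limit_implicit]); the stationary pressure then
    forces its velocity to be proportional to (g', 1). *)

(** * Derivatives along a subset of the line, as limits of slopes *)

Lemma filterlim_add {T : Type} (G : (T -> Prop) -> Prop) (FG : Filter G)
    (f g : T -> R) (a b : R) :
  filterlim f G (locally a) -> filterlim g G (locally b) ->
  filterlim (fun s => f s + g s) G (locally (a + b)).
Proof.
  intros Hf Hg.
  exact (filterlim_comp_2 f g Rplus Hf Hg (filterlim_plus (K := R_AbsRing) (V := R_NormedModule) a b)).
Qed.

Lemma filterlim_mul {T : Type} (G : (T -> Prop) -> Prop) (FG : Filter G)
    (f g : T -> R) (a b : R) :
  filterlim f G (locally a) -> filterlim g G (locally b) ->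
  filterlim (fun s => f s * g s) G (locally (a * b)).
Proof.
  intros Hf Hg.
  exact (filterlim_comp_2 f g Rmult Hf Hg (filterlim_mult (K := R_AbsRing) a b)).
Qed.

Lemma filterlim_inv {T : Type} (G : (T -> Prop) -> Prop) (FG : Filter G)
    (f : T -> R) (a : R) :
  a <> 0 -> filterlim f G (locally a) ->
  filterlim (fun s => / f s) G (locally (/ a)).
Proof.
  intros Ha Hf.
  exact (filterlim_comp _ _ _ f Rinv _ _ _ Hf (continuous_Rinv a Ha)).
Qed.

Lemma filterlim_locally_pair {T : Type} (G : (T -> Prop) -> Prop) (FG : Filter G)
    {U V : UniformSpace} (x : T -> U) (y : T -> V) (x0 : U) (y0 : V) :
  filterlim x G (locally x0) -> filterlim y G (locally y0) ->
  filterlim (fun s => (x s, y s)) G (locally (x0, y0)).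
Proof.
  intros Hx Hy.
  apply (proj2 (@filterlim_locally _ _ G FG (fun s => (x s, y s)) (x0, y0))).
  intros eps.
  generalize (filter_and _ _ (proj1 (filterlim_locally _ _) Hx eps)
                (proj1 (filterlim_locally _ _) Hy eps)).
  apply filter_imp. intros s [H1 H2]. split; assumption.
Qed.

Lemma filterlim_comp_2d {T : Type} (G : (T -> Prop) -> Prop) (FG : Filter G)
    (A : R -> R -> R) (x y : T -> R) (x0 y0 : R) :
  continuity_2d_pt A x0 y0 ->
  filterlim x G (locally x0) -> filterlim y G (locally y0) ->
  filterlim (fun s => A (x s) (y s)) G (locally (A x0 y0)).
Proof.
  intros HA Hx Hy.
  apply continuity_2d_pt_filterlim in HA.
  exact (filterlim_comp _ _ _ (fun s => (x s, y s)) _ _ _ _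
           (filterlim_locally_pair _ _ x y x0 y0 Hx Hy) HA).
Qed.

(** Carathéodory's form of differentiability: the increment of F is a combination of the
    increments of the variables whose coefficients are continuous at the point.  It turns
    the chain rule and implicit differentiation along any filter into algebra of limits. *)
Lemma differentiable_slopes (F : R -> R -> R) (x0 y0 a b : R) :
  differentiable_pt_lim F x0 y0 a b ->
  exists A B : R -> R -> R,
    continuity_2d_pt A x0 y0 /\ A x0 y0 = a /\
    continuity_2d_pt B x0 y0 /\ B x0 y0 = b /\
    forall u v, F u v - F x0 y0 = A u v * (u - x0) + B u v * (v - y0).
Proof.
  intros HF.
  (* The remainder, divided by the l1 norm of the increment, is shared between the two
     coefficients; Rabs d / d is the sign of d, with value 0 at d = 0. *)
  set (q := fun u v => (F u v - F x0 y0 - (a * (u - x0) + b * (v - y0)))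
                       / (Rabs (u - x0) + Rabs (v - y0))).
  assert (Hsgn : forall d, Rabs (Rabs d / d) <= 1).
  { intros d. destruct (Req_dec d 0) as [->|Hd].
    - rewrite Rabs_R0. unfold Rdiv. rewrite Rmult_0_l, Rabs_R0. lra.
    - unfold Rdiv. rewrite Rabs_mult, Rabs_Rabsolu, Rabs_inv, Rinv_r.
      + lra.
      + now apply Rabs_no_R0. }
  assert (Hsgn2 : forall d, Rabs d / d * d = Rabs d).
  { intros d. destruct (Req_dec d 0) as [->|Hd].
    - rewrite Rabs_R0. ring.
    - field. exact Hd. }
  assert (Hq : forall eps : posreal, locally_2d (fun u v => Rabs (q u v) <= eps) x0 y0).
  { intros eps. destruct (HF eps) as [d Hd]. exists d. intros u v Hu Hv.
    specialize (Hd u v Hu Hv). unfold q.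
    set (r := F u v - F x0 y0 - (a * (u - x0) + b * (v - y0))) in *.
    pose proof (Rabs_pos (u - x0)) as P1. pose proof (Rabs_pos (v - y0)) as P2.
    set (n := Rabs (u - x0) + Rabs (v - y0)).
    pose proof (cond_pos eps) as Pe.
    assert (Hn : Rabs r <= eps * n).
    { eapply Rle_trans; [exact Hd|]. apply Rmult_le_compat_l; [lra|].
      unfold n. apply Rmax_lub; lra. }
    destruct (Req_dec n 0) as [H0|H0].
    - rewrite H0 in *. rewrite Rmult_0_r in Hn.
      assert (r = 0) as ->.
      { apply Rabs_eq_0. pose proof (Rabs_pos r). lra. }
      unfold Rdiv. rewrite Rmult_0_l, Rabs_R0. lra.
    - assert (0 < n) by (unfold n in *; lra).
      unfold Rdiv. rewrite Rabs_mult, Rabs_inv, (Rabs_pos_eq n) by lra.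
      apply Rmult_le_reg_r with n; [lra|].
      rewrite Rmult_assoc, Rinv_l by lra. lra. }
  assert (Hq0 : q x0 y0 = 0).
  { unfold q. replace (F x0 y0 - F x0 y0 - _) with 0 by ring. unfold Rdiv. ring. }
  assert (Hcont : forall c (k : R -> R -> R), (forall u v, Rabs (k u v) <= 1) ->
            continuity_2d_pt (fun u v => c + q u v * k u v) x0 y0).
  { intros c k Hk eps.
    destruct (Hq (pos_div_2 eps)) as [d Hd]. exists d. intros u v Hu Hv.
    specialize (Hd u v Hu Hv). simpl in Hd.
    rewrite Hq0. replace (c + q u v * k u v - (c + 0 * k x0 y0)) with (q u v * k u v) by ring.
    rewrite Rabs_mult. specialize (Hk u v).
    pose proof (Rabs_pos (q u v)). pose proof (Rabs_pos (k u v)).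
    pose proof (cond_pos eps). nra. }
  exists (fun u v => a + q u v * (Rabs (u - x0) / (u - x0))).
  exists (fun u v => b + q u v * (Rabs (v - y0) / (v - y0))).
  repeat split.
  - apply Hcont. intros; apply Hsgn.
  - rewrite Hq0; ring.
  - apply Hcont. intros; apply Hsgn.
  - rewrite Hq0; ring.
  - intros u v.
    rewrite !Rmult_plus_distr_r, !Rmult_assoc, !Hsgn2.
    assert (q u v * (Rabs (u - x0) + Rabs (v - y0))
            = F u v - F x0 y0 - (a * (u - x0) + b * (v - y0))).
    { destruct (Req_dec (Rabs (u - x0) + Rabs (v - y0)) 0) as [H0|H0].
      - pose proof (Rabs_pos (u - x0)). pose proof (Rabs_pos (v - y0)).
        assert (u - x0 = 0) by (apply Rabs_eq_0; lra).
        assert (v - y0 = 0) by (apply Rabs_eq_0; lra).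
        rewrite H0. replace u with x0 by lra. replace v with y0 by lra. ring.
      - unfold q. field. exact H0. }
    lra.
Qed.

(** Working with [slope_limit] along this filter rather than with [is_derive_within]
    gives one-sided derivatives at the initial time and ordinary ones at interior points by the same lemmas. *)
Definition punctured (J : R -> Prop) (t : R) : (R -> Prop) -> Prop :=
  within (fun s => J s /\ s <> t) (locally t).

Definition slope_limit (J : R -> Prop) (f : R -> R) (t l : R) : Prop :=
  filterlim (fun s => (f s - f t) / (s - t)) (punctured J t) (locally l).

#[local] Instance punctured_filter J t : Filter (punctured J t).
Proof. unfold punctured. apply within_filter. apply locally_filter. Qed.

Lemma punctured_domain J t : punctured J t (fun s => J s /\ s <> t).
Proof. unfold punctured, within. apply filter_forall. tauto. Qed.

Lemma slope_limit_ext J f g t l :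
  J t -> (forall s, J s -> f s = g s) -> slope_limit J f t l -> slope_limit J g t l.
Proof.
  intros Ht Hfg. unfold slope_limit. apply filterlim_ext_loc.
  generalize (punctured_domain J t). apply filter_imp.
  intros s [Hs _]. now rewrite (Hfg s Hs), (Hfg t Ht).
Qed.

Lemma slope_limit_continuous J f t l :
  slope_limit J f t l -> filterlim f (punctured J t) (locally (f t)).
Proof.
  intros H.
  apply filterlim_ext_loc with (fun s => (f s - f t) / (s - t) * (s - t) + f t).
  - generalize (punctured_domain J t). apply filter_imp.
    intros s [_ Hs]. field. lra.
  - assert (E : l * (t + - t) + f t = f t) by ring.
    enough (H' : filterlim (fun s => (f s - f t) / (s - t) * (s - t) + f t)
                   (punctured J t) (locally (l * (t + - t) + f t)))
      by (rewrite E in H'; exact H').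
    apply filterlim_add; [typeclasses eauto| |apply filterlim_const].
    apply filterlim_mul; [typeclasses eauto|exact H|].
    apply filterlim_add; [typeclasses eauto| |apply filterlim_const].
    intros Q HQ. unfold filtermap, punctured, within.
    revert HQ. apply filter_imp. tauto.
Qed.

Lemma slope_limit_unique J t f l1 l2 :
  (forall eps : posreal, exists s, J s /\ s <> t /\ Rabs (s - t) < eps) ->
  slope_limit J f t l1 -> slope_limit J f t l2 -> l1 = l2.
Proof.
  intros HJ H1 H2.
  assert (PF : ProperFilter' (punctured J t)).
  { constructor; [|apply punctured_filter].
    intros [eps Heps]. destruct (HJ eps) as (s & Hs & Hst & Hd).
    exact (Heps s Hd (conj Hs Hst)). }
  exact (filterlim_locally_unique (K := R_AbsRing) (V := R_NormedModule) _ l1 l2 H1 H2).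
Qed.

Lemma slope_limit_of_is_derive_within J (f : R -> R) t l :
  is_derive_within J f t l -> slope_limit J f t l.
Proof.
  intros [_ H]. apply filterlim_locally. intros eps.
  assert (Hl : is_filter_lim (within J (locally t)) t).
  { intros Q HQ. unfold within. revert HQ. apply filter_imp. tauto. }
  specialize (H t Hl (pos_div_2 eps)). unfold punctured, within in *.
  revert H. apply filter_imp. intros s H [HJ Hs]. specialize (H HJ).
  change (Rabs ((f s - f t) / (s - t) - l) < eps).
  change (Rabs ((f s + - f t) + - ((s + - t) * l)) <= eps / 2 * Rabs (s + - t)) in H.
  assert (Hp : 0 < Rabs (s - t)) by (apply Rabs_pos_lt; lra).
  apply Rmult_lt_reg_r with (Rabs (s - t)); [exact Hp|].
  rewrite <- Rabs_mult.
  replace (((f s - f t) / (s - t) - l) * (s - t)) with ((f s + - f t) + - ((s + - t) * l))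
    by (field; lra).
  replace (s - t) with (s + - t) in * by ring.
  pose proof (cond_pos eps). nra.
Qed.

Lemma is_derive_of_slope_limit J (f : R -> R) t l :
  locally t J -> slope_limit J f t l -> is_derive f t l.
Proof.
  intros HJ H. apply is_derive_Reals. intros eps Heps.
  destruct (filter_and _ _ HJ (proj1 (filterlim_locally _ _) H (mkposreal eps Heps)))
    as [d Hd].
  exists d. intros h Hh Hhd.
  assert (Hb : ball t d (t + h)).
  { change (Rabs (t + h + - t) < d). now replace (t + h + - t) with h by ring. }
  destruct (Hd (t + h) Hb) as [HJh Hl].
  assert (Hne : t + h <> t) by lra.
  specialize (Hl (conj HJh Hne)).
  change (Rabs ((f (t + h) - f t) / (t + h - t) + - l) < eps) in Hl.
  now replace (t + h - t) with h in Hl by ring.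
Qed.

Lemma slope_limit_const J c t : slope_limit J (fun _ => c) t 0.
Proof.
  apply filterlim_ext_loc with (fun _ => 0); [|apply filterlim_const].
  generalize (punctured_domain J t). apply filter_imp. intros s [_ Hs]. field. lra.
Qed.

Lemma slope_limit_id J t : slope_limit J (fun s => s) t 1.
Proof.
  apply filterlim_ext_loc with (fun _ => 1); [|apply filterlim_const].
  generalize (punctured_domain J t). apply filter_imp. intros s [_ Hs]. field. lra.
Qed.

Lemma slope_limit_comp J F x y t a b x' y' :
  differentiable_pt_lim F (x t) (y t) a b ->
  slope_limit J x t x' -> slope_limit J y t y' ->
  slope_limit J (fun s => F (x s) (y s)) t (a * x' + b * y').
Proof.
  intros HF Hx Hy.
  destruct (differentiable_slopes F (x t) (y t) a b HF)
    as (A & B & HA & <- & HB & <- & HAB).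
  pose proof (slope_limit_continuous _ _ _ _ Hx) as Cx.
  pose proof (slope_limit_continuous _ _ _ _ Hy) as Cy.
  unfold slope_limit.
  apply filterlim_ext_loc with
    (fun s => A (x s) (y s) * ((x s - x t) / (s - t))
              + B (x s) (y s) * ((y s - y t) / (s - t))).
  - generalize (punctured_domain J t). apply filter_imp.
    intros s [_ Hs]. rewrite HAB. field. lra.
  - apply filterlim_add; [typeclasses eauto|..];
      (apply filterlim_mul; [typeclasses eauto|apply filterlim_comp_2d|]); auto;
      typeclasses eauto.
Qed.

(** Differentiability of an implicit function: when y is merely continuous but F(x, y)
    and x have slopes, the slope of y is found by solving the Carathéodory identity for
    it, which b <> 0 permits. *)
Lemma slope_limit_implicit J F x y t a b x' w' :
  b <> 0 ->
  differentiable_pt_lim F (x t) (y t) a b ->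
  slope_limit J x t x' ->
  filterlim y (punctured J t) (locally (y t)) ->
  slope_limit J (fun s => F (x s) (y s)) t w' ->
  slope_limit J y t ((w' - a * x') / b).
Proof.
  intros Hb HF Hx Cy Hw.
  destruct (differentiable_slopes F (x t) (y t) a b HF)
    as (A & B & HA & <- & HB & <- & HAB).
  pose proof (slope_limit_continuous _ _ _ _ Hx) as Cx.
  pose proof (filterlim_comp_2d _ _ _ _ _ _ _ HA Cx Cy) as CA.
  pose proof (filterlim_comp_2d _ _ _ _ _ _ _ HB Cx Cy) as CB.
  assert (CB0 : punctured J t (fun s => B (x s) (y s) <> 0)).
  { exact (CB (fun z => z <> 0) (open_neq 0 _ Hb)). }
  unfold slope_limit.
  apply filterlim_ext_loc with
    (fun s => ((F (x s) (y s) - F (x t) (y t)) / (s - t)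
               + (-1) * (A (x s) (y s) * ((x s - x t) / (s - t)))) * / B (x s) (y s)).
  - generalize (filter_and _ _ (punctured_domain J t) CB0). apply filter_imp.
    intros s [[_ Hs] HB0]. rewrite HAB. field. split; [lra|exact HB0].
  - replace ((w' - _) / _)
      with ((w' + (-1) * (A (x t) (y t) * x')) * / B (x t) (y t)) by (field; exact Hb).
    apply filterlim_mul; [typeclasses eauto| |apply filterlim_inv; auto; typeclasses eauto].
    apply filterlim_add; [typeclasses eauto|exact Hw|].
    apply filterlim_mul; [typeclasses eauto|apply filterlim_const|].
    apply filterlim_mul; [typeclasses eauto|exact CA|exact Hx].
Qed.

Lemma slope_limit_comp_1 J f x t a x' :
  is_derive f (x t) a -> slope_limit J x t x' ->
  slope_limit J (fun s => f (x s)) t (a * x').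
Proof.
  intros Hf Hx. replace (a * x') with (a * x' + 0 * x') by ring.
  apply (slope_limit_comp J (fun u _ => f u) x x); trivial.
  apply differentiable_pt_lim_proj1_0. now apply is_derive_Reals.
Qed.

Lemma slope_limit_mult J x y t x' y' :
  slope_limit J x t x' -> slope_limit J y t y' ->
  slope_limit J (fun s => x s * y s) t (y t * x' + x t * y').
Proof.
  apply slope_limit_comp. intros eps. exists eps. intros u v Hu Hv.
  replace (u * v - x t * y t - (y t * (u - x t) + x t * (v - y t)))
    with ((u - x t) * (v - y t)) by ring.
  rewrite Rabs_mult. apply Rmult_le_compat; try apply Rabs_pos; [lra|apply Rmax_r].
Qed.

Lemma slope_limit_minus J x y t x' y' :
  slope_limit J x t x' -> slope_limit J y t y' ->
  slope_limit J (fun s => x s - y s) t (x' - y').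
Proof.
  intros Hx Hy. replace (x' - y') with (1 * x' + (-1) * y') by ring.
  apply (slope_limit_comp J Rminus); trivial.
  intros eps. exists eps. intros u v _ _.
  replace (u - v - (x t - y t) - _) with 0 by ring.
  rewrite Rabs_R0. apply Rmult_le_pos; [left; apply cond_pos|].
  eapply Rle_trans; [apply Rabs_pos|apply Rmax_l].
Qed.

Lemma is_derive_within_linear {V : NormedModule R_AbsRing} (l : V -> R) J (f : R -> V) t df :
  is_linear (U := V) (V := R_NormedModule) l ->
  is_derive_within J f t df -> is_derive_within J (fun s => l (f s)) t (l df).
Proof.
  intros Hl Hf. unfold is_derive_within.
  apply filterdiff_ext_lin with (fun dt : R => l (scal dt df)).
  - apply (filterdiff_comp f l); [exact Hf|]. now apply filterdiff_linear.
  - intros dt. exact (@linear_scal R_AbsRing V R_NormedModule l Hl dt df).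
Qed.

(** * Solving F x y = w for y when F increases in y *)

Definition increasing_at (F : R -> R -> R) (x y : R) : Prop :=
  continuity_2d_pt F x y /\ ex_derive (F x) y /\ 0 < Derive (F x) y.

Lemma increasing_on_fibres F x0 y0 (r : R) :
  (forall x y, Rabs (x - x0) < r -> Rabs (y - y0) < r -> increasing_at F x y) ->
  forall x y1 y2, Rabs (x - x0) < r -> Rabs (y1 - y0) < r -> Rabs (y2 - y0) < r ->
    y1 < y2 -> F x y1 < F x y2.
Proof.
  intros HF x y1 y2 Hx H1 H2 H12.
  assert (Hin : forall y, y1 <= y <= y2 -> increasing_at F x y).
  { intros y Hy. apply HF; trivial.
    apply Rabs_def2 in H1. apply Rabs_def2 in H2. apply Rabs_def1; lra. }
  destruct (MVT_gen (F x) y1 y2 (Derive (F x))) as (c & Hc & E).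
  - rewrite Rmin_left, Rmax_right by lra. intros y Hy.
    apply Derive_correct. apply Hin. lra.
  - rewrite Rmin_left, Rmax_right by lra. intros y Hy.
    apply continuity_pt_filterlim. apply (ex_derive_continuous (F x)). apply Hin. lra.
  - rewrite Rmin_left, Rmax_right in Hc by lra.
    destruct (Hin c Hc) as (_ & _ & Hd). nra.
Qed.

Lemma injective_on_fibres F x0 y0 (r : R) :
  (forall x y, Rabs (x - x0) < r -> Rabs (y - y0) < r -> increasing_at F x y) ->
  forall x y1 y2, Rabs (x - x0) < r -> Rabs (y1 - y0) < r -> Rabs (y2 - y0) < r ->
    F x y1 = F x y2 -> y1 = y2.
Proof.
  intros HF x y1 y2 Hx H1 H2 E.
  pose proof (increasing_on_fibres F x0 y0 r HF x) as HI.
  destruct (Rtotal_order y1 y2) as [H|[H|H]]; trivial.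
  - specialize (HI y1 y2 Hx H1 H2 H). lra.
  - specialize (HI y2 y1 Hx H2 H1 H). lra.
Qed.

(** By monotonicity, w0 = F x0 y0 lies strictly between the values of F x0 at the two
    ends of a small interval around y0; by continuity of F at these two points the same
    bracketing holds for (x, w) near (x0, w0), and the intermediate value theorem
    applies. *)
Lemma local_solution F x0 y0 (d : R) :
  0 < d -> locally_2d (increasing_at F) x0 y0 ->
  exists r : posreal, forall x w, Rabs (x - x0) < r -> Rabs (w - F x0 y0) < r ->
    exists y, Rabs (y - y0) < d /\ F x y = w.
Proof.
  intros Hd [r0 HF].
  pose proof (cond_pos r0) as Hr0.
  set (k := Rmin d r0 / 2).
  assert (Hk : 0 < k /\ k < d /\ k < r0).
  { unfold k. pose proof (Rmin_l d r0). pose proof (Rmin_r d r0).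
    assert (0 < Rmin d r0) by (apply Rmin_pos; lra). lra. }
  assert (H0 : Rabs (x0 - x0) < r0) by (rewrite Rminus_diag, Rabs_R0; lra).
  assert (Hy : forall y, y0 - k <= y <= y0 + k -> Rabs (y - y0) < r0).
  { intros y Hy. apply Rabs_def1; lra. }
  pose proof (increasing_on_fibres F x0 y0 r0 HF x0 (y0 - k) y0 H0
                ltac:(apply Hy; lra) ltac:(apply Hy; lra) ltac:(lra)) as I1.
  pose proof (increasing_on_fibres F x0 y0 r0 HF x0 y0 (y0 + k) H0
                ltac:(apply Hy; lra) ltac:(apply Hy; lra) ltac:(lra)) as I2.
  set (g := Rmin (F x0 y0 - F x0 (y0 - k)) (F x0 (y0 + k) - F x0 y0) / 2).
  assert (Hg : 0 < g /\ F x0 (y0 - k) <= F x0 y0 - 2 * g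
               /\ F x0 y0 + 2 * g <= F x0 (y0 + k)).
  { unfold g.
    pose proof (Rmin_l (F x0 y0 - F x0 (y0 - k)) (F x0 (y0 + k) - F x0 y0)).
    pose proof (Rmin_r (F x0 y0 - F x0 (y0 - k)) (F x0 (y0 + k) - F x0 y0)).
    assert (0 < Rmin (F x0 y0 - F x0 (y0 - k)) (F x0 (y0 + k) - F x0 y0))
      by (apply Rmin_pos; lra). lra. }
  destruct (proj1 (HF x0 (y0 - k) H0 ltac:(apply Hy; lra)) (mkposreal g (proj1 Hg)))
    as [r1 Hr1].
  destruct (proj1 (HF x0 (y0 + k) H0 ltac:(apply Hy; lra)) (mkposreal g (proj1 Hg)))
    as [r2 Hr2].
  simpl in Hr1, Hr2.
  set (r := Rmin (Rmin r1 r2) (Rmin g r0)).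
  assert (Hr : 0 < r).
  { unfold r. repeat apply Rmin_pos; try apply cond_pos. apply Hg. }
  assert (Hr' : r <= r1 /\ r <= r2 /\ r <= g /\ r <= r0).
  { unfold r. pose proof (Rmin_l (Rmin r1 r2) (Rmin g r0)).
    pose proof (Rmin_r (Rmin r1 r2) (Rmin g r0)).
    pose proof (Rmin_l r1 r2). pose proof (Rmin_r r1 r2).
    pose proof (Rmin_l g r0). pose proof (Rmin_r g r0). lra. }
  exists (mkposreal r Hr). simpl. intros x w Hx Hw.
  assert (Z : forall z : R, Rabs (z - z) = 0) by (intros; rewrite Rminus_diag; apply Rabs_R0).
  specialize (Hr1 x (y0 - k) ltac:(lra) ltac:(rewrite Z; apply cond_pos)).
  specialize (Hr2 x (y0 + k) ltac:(lra) ltac:(rewrite Z; apply cond_pos)).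
  apply Rabs_def2 in Hr1. apply Rabs_def2 in Hr2. apply Rabs_def2 in Hw.
  destruct (Ranalysis5.IVT_interv (fun y => F x y - w) (y0 - k) (y0 + k)) as (y & Hyk & E).
  - intros y Hyk. apply continuity_pt_minus.
    + apply continuity_pt_filterlim. apply (ex_derive_continuous (F x)).
      apply HF; [lra|now apply Hy].
    + apply continuity_pt_const. now intros ? ?.
  - lra.
  - lra.
  - lra.
  - exists y. split; [apply Rabs_def1; lra|lra].
Qed.

(** The set D of good points is carried along so that it can express that the graph of g
    stays in a given open set. *)
Lemma implicit_function F (D : R -> R -> Prop) x0 y0 :
  locally_2d (fun x y => increasing_at F x y /\ D x y) x0 y0 ->
  exists (r d : posreal) (g : R -> R),
    g x0 = y0 /\
    (forall x, Rabs (x - x0) < r ->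
       F x (g x) = F x0 y0 /\ increasing_at F x (g x) /\ D x (g x) /\ continuous g x) /\
    (forall x y, Rabs (x - x0) < r -> Rabs (y - y0) < d -> F x y = F x0 y0 -> y = g x).
Proof.
  intros [d HD].
  pose proof (cond_pos d) as Hd.
  assert (HF : forall x y, Rabs (x - x0) < d -> Rabs (y - y0) < d -> increasing_at F x y)
    by (intros; now apply HD).
  pose proof (injective_on_fibres F x0 y0 d HF) as Hinj.
  destruct (local_solution F x0 y0 d Hd) as [r1 Hr1].
  { exists d. exact HF. }
  assert (Hr : 0 < Rmin r1 d) by (apply Rmin_pos; apply cond_pos).
  assert (Hex : exists r : posreal, r <= r1 /\ r <= d).
  { exists (mkposreal _ Hr). split; [apply Rmin_l|apply Rmin_r]. }
  destruct Hex as [r Hrr].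
  set (g := fun x => epsilon (inhabits 0) (fun y => Rabs (y - y0) < d /\ F x y = F x0 y0)).
  assert (Z : forall z : R, Rabs (z - z) = 0) by (intros; rewrite Rminus_diag; apply Rabs_R0).
  assert (Hg : forall x, Rabs (x - x0) < r -> Rabs (g x - y0) < d /\ F x (g x) = F x0 y0).
  { intros x Hx. apply (epsilon_spec (inhabits 0) (fun y => Rabs (y - y0) < d /\ F x y = F x0 y0)).
    apply Hr1; [lra|]. rewrite Z. apply cond_pos. }
  assert (Hu : forall x y, Rabs (x - x0) < r -> Rabs (y - y0) < d ->
                 F x y = F x0 y0 -> y = g x).
  { intros x y Hx Hy E. destruct (Hg x Hx) as [G1 G2].
    apply (Hinj x); trivial; [lra|congruence]. }
  exists r, d, g. refine (conj _ (conj _ Hu)).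
  - symmetry. apply Hu; trivial; rewrite Z; apply cond_pos.
  - intros x1 Hx1. destruct (Hg x1 Hx1) as [G1 G2].
    refine (conj G2 (conj _ (conj _ _))); [apply HF; lra|exact (proj2 (HD x1 (g x1) ltac:(lra) G1))|].
    apply filterlim_locally. intros eps.
    assert (Hk : 0 < Rmin eps (d - Rabs (g x1 - y0)))
      by (apply Rmin_pos; [apply cond_pos|lra]).
    (* Continuity at x1: solve near (x1, g x1) within the tolerance eps; by uniqueness the
       solution found is g. *)
    destruct (local_solution F x1 (g x1) _ Hk) as [r2 Hr2].
    { assert (Hk2 : 0 < Rmin (r - Rabs (x1 - x0)) (d - Rabs (g x1 - y0)))
        by (apply Rmin_pos; lra).
      exists (mkposreal _ Hk2). simpl. intros u v Hu1 Hv1.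
      pose proof (Rmin_l (r - Rabs (x1 - x0)) (d - Rabs (g x1 - y0))).
      pose proof (Rmin_r (r - Rabs (x1 - x0)) (d - Rabs (g x1 - y0))).
      pose proof (Rabs_triang (u - x1) (x1 - x0)) as T1.
      pose proof (Rabs_triang (v - g x1) (g x1 - y0)) as T2.
      replace (u - x1 + (x1 - x0)) with (u - x0) in T1 by ring.
      replace (v - g x1 + (g x1 - y0)) with (v - y0) in T2 by ring.
      apply HF; lra. }
    assert (Hk3 : 0 < Rmin r2 (r - Rabs (x1 - x0)))
      by (apply Rmin_pos; [apply cond_pos|lra]).
    exists (mkposreal _ Hk3). intros x Hx.
    change (Rabs (x + - x1) < Rmin r2 (r - Rabs (x1 - x0))) in Hx.
    pose proof (Rmin_l r2 (r - Rabs (x1 - x0))).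
    pose proof (Rmin_r r2 (r - Rabs (x1 - x0))).
    pose proof (Rmin_l eps (d - Rabs (g x1 - y0))).
    pose proof (Rmin_r eps (d - Rabs (g x1 - y0))).
    destruct (Hr2 x (F x0 y0)) as (y & Hy & Ey).
    + unfold Rminus. lra.
    + rewrite G2, Z. apply cond_pos.
    + assert (y = g x) as <-.
      { apply Hu; trivial.
        - pose proof (Rabs_triang (x - x1) (x1 - x0)) as T1.
          replace (x - x1 + (x1 - x0)) with (x - x0) in T1 by ring.
          unfold Rminus in *. lra.
        - pose proof (Rabs_triang (y - g x1) (g x1 - y0)) as T1.
          replace (y - g x1 + (g x1 - y0)) with (y - y0) in T1 by ring. lra. }
      change (Rabs (y - g x1) < eps). lra.
Qed.

(** * Functions of two variables and plane curves *)

Lemma differentiable_of_C1 (f : R -> R -> R) (S : R * R -> Prop) x y :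
  open S -> (forall x y, S (x, y) -> ex_diff_n f 1 x y) -> S (x, y) ->
  differentiable_pt_lim f x y (Derive (fun z => f z y) x) (Derive (fun z => f x z) y).
Proof.
  intros HS Hf Hxy. apply filterdiff_differentiable_pt_lim.
  apply (is_derive_filterdiff f x y (fun u v => Derive (fun z => f z v) u)).
  - specialize (HS (x, y) Hxy). revert HS. apply filter_imp.
    intros [u v] H. apply Derive_correct. apply (Hf u v H).
  - apply Derive_correct. apply (Hf x y Hxy).
  - destruct (Hf x y Hxy) as (_ & _ & _ & [H _] & _).
    now apply continuity_2d_pt_filterlim in H.
Qed.

Lemma open_box (S : R * R -> Prop) x y :
  open S -> S (x, y) -> locally_2d (fun u v => S (u, v)) x y.
Proof.
  intros HS Hxy. apply locally_2d_locally. generalize (HS (x, y) Hxy).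
  apply filter_imp. now intros [u v].
Qed.

Lemma locally_2d_swap (Q : R -> R -> Prop) x y :
  locally_2d Q x y -> locally_2d (fun v u => Q u v) y x.
Proof. intros [d H]. exists d. auto. Qed.

Lemma continuity_2d_pt_swap (f : R -> R -> R) x y :
  continuity_2d_pt f x y -> continuity_2d_pt (fun v u => f u v) y x.
Proof. intros H eps. destruct (H eps) as [d Hd]. exists d. auto. Qed.

Lemma differentiable_swap (f : R -> R -> R) x y a b :
  differentiable_pt_lim f x y a b -> differentiable_pt_lim (fun v u => f u v) y x b a.
Proof.
  intros H eps. destruct (H eps) as [d Hd]. exists d. intros v u Hv Hu.
  rewrite Rmax_comm, (Rplus_comm (b * _)). auto.
Qed.

Lemma is_derive_pair (f g : R -> R) (t a b : R) :
  is_derive f t a -> is_derive g t b -> is_derive (fun s => (f s, g s)) t (a, b).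
Proof.
  intros Hf Hg.
  refine (filterdiff_comp'_2 (K := R_AbsRing) (T := R_NormedModule) (U := R_NormedModule) (V := R_NormedModule) f g (fun u v => (u, v)) t (fun dt : R => scal dt a)
     (fun dt : R => scal dt b) (fun u v => (u, v)) Hf Hg _).
  apply filterdiff_ext with (fun z => z); [now intros []|].
  apply filterdiff_ext_lin with (fun z => z); [|now intros []].
  apply filterdiff_id.
Qed.

(** * The change of coordinates in an admissible regime *)

(** The two equations say that (nu', sigma'), with nu' = - n^2 rho', is tangent to the
    level set of e_nu and that it has the prescribed energy rate; the conclusion is that
    (rho', eps') is sigma' times the image under the differential of (1 / nu, e / nu) of
    the vector (k, 1). *)
Lemma tangent_components (n e0 en es enn ens rho' eps' sigma' : R) :
  0 < n -> 0 < enn ->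
  enn * (- n ^ 2 * rho') + ens * sigma' = 0 ->
  es * sigma' = n * eps' + e0 / n * (- n ^ 2 * rho') - en * (- n ^ 2 * rho') ->
  let k := - ens / enn in
  rho' = sigma' * (- k / n ^ 2) /\
  eps' = sigma' * ((en * k + es) / n - e0 * k / n ^ 2).
Proof.
  intros Hn Hnn E1 E2 k.
  assert (Ek : - n ^ 2 * rho' = k * sigma').
  { unfold k. apply (Rmult_eq_reg_l enn); [|lra].
    replace (enn * (- ens / enn * sigma')) with (- (ens * sigma')) by (field; lra). lra. }
  rewrite Ek in E2. split.
  - replace rho' with (- (- n ^ 2 * rho') / n ^ 2) by (field; lra).
    rewrite Ek. field. lra.
  - replace (sigma' * _) with ((es * sigma' + en * (k * sigma') - e0 / n * (k * sigma')) / n)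
      by (field; lra).
    rewrite E2. field. lra.
Qed.

Section Regime.
Context {smin : R} {e : R -> R -> R} {S : R * R -> Prop}
  (HS : admissible_regime smin e S).

Notation e_nu := (fun nu sigma => Derive (fun u => e u sigma) nu).
Notation e_sigma := (fun nu sigma => Derive (fun u => e nu u) sigma).
Notation e_nu_nu := (fun nu sigma => Derive (fun u => e_nu u sigma) nu).
Notation e_nu_sigma := (fun nu sigma => Derive (fun u => e_nu nu u) sigma).

Lemma regime_nu_pos nu sigma : S (nu, sigma) -> 0 < nu.
Proof.
  intros H. exact (proj1 (locally_singleton _ _ (regime_interior _ _ _ HS _ H))).
Qed.

Lemma energy_C1 nu sigma : S (nu, sigma) -> ex_diff_n e 1 nu sigma.
Proof. intros H. apply (ex_diff_n_m 2 1); [lia|]. now apply (regime_C2 _ _ _ HS). Qed.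

Lemma energy_nu_C1 nu sigma : S (nu, sigma) -> ex_diff_n e_nu 1 nu sigma.
Proof.
  intros H. apply ex_diff_n_deriv_aux1. now apply (regime_C2 _ _ _ HS).
Qed.

Lemma energy_increasing nu sigma : S (nu, sigma) -> increasing_at e nu sigma.
Proof.
  intros H. destruct (energy_C1 nu sigma H) as (Hc & _ & Hd & _).
  refine (conj Hc (conj Hd _)). exact (regime_temperature_pos _ _ _ HS nu sigma H).
Qed.

(** The arguments are exchanged because isobars are solved for nu in terms of sigma. *)
Lemma energy_nu_increasing nu sigma :
  S (nu, sigma) -> increasing_at (fun s u => e_nu u s) sigma nu.
Proof.
  intros H. destruct (energy_nu_C1 nu sigma H) as (Hc & Hd & _).
  refine (conj (continuity_2d_pt_swap _ _ _ Hc) (conj Hd _)).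
  exact (proj1 (regime_convex _ _ _ HS nu sigma H)).
Qed.

Lemma Phi_injective x y : S x -> S y -> Phi e x = Phi e y -> x = y.
Proof.
  destruct x as [n1 s1], y as [n2 s2]. unfold Phi; simpl. intros H1 H2 E.
  pose proof (regime_nu_pos _ _ H1). pose proof (regime_nu_pos _ _ H2).
  injection E as E1 E2.
  assert (n1 = n2) as <-.
  { rewrite <- (Rinv_inv n1), <- (Rinv_inv n2). f_equal. lra. }
  f_equal. apply (regime_injective _ _ _ HS n1); trivial.
  apply Rmult_eq_reg_r with (/ n1); [exact E2|]. apply Rinv_neq_0_compat. lra.
Qed.

Lemma Phi_inv_spec tau : S_tau e S tau -> S (Phi_inv e S tau) /\ Phi e (Phi_inv e S tau) = tau.
Proof. exact (epsilon_spec (inhabits (0, 0)) (fun x => S x /\ Phi e x = tau)). Qed.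

Lemma Phi_inv_Phi x : S x -> Phi_inv e S (Phi e x) = x.
Proof.
  intros Hx. destruct (Phi_inv_spec (Phi e x)) as [H1 H2]; [now exists x|].
  now apply Phi_injective.
Qed.

Lemma Phi_inv_fst tau : S_tau e S tau -> fst (Phi_inv e S tau) = / fst tau.
Proof.
  intros H. destruct (Phi_inv_spec tau H) as [H1 H2].
  destruct (Phi_inv e S tau) as [nu sigma]. pose proof (regime_nu_pos _ _ H1).
  rewrite <- H2. simpl. field. lra.
Qed.

Lemma S_tau_rho_pos tau : S_tau e S tau -> 0 < fst tau.
Proof.
  intros ([nu sigma] & Hx & <-). pose proof (regime_nu_pos _ _ Hx).
  apply Rdiv_lt_0_compat; simpl; lra.
Qed.

Lemma energy_Phi_inv tau :
  S_tau e S tau ->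
  e (fst (Phi_inv e S tau)) (snd (Phi_inv e S tau)) = snd tau * / fst tau.
Proof.
  intros H. rewrite <- (Phi_inv_fst tau H).
  destruct (Phi_inv_spec tau H) as [H1 H2].
  destruct (Phi_inv e S tau) as [nu sigma]. pose proof (regime_nu_pos _ _ H1).
  rewrite <- H2. simpl. field. lra.
Qed.

Lemma filterlim_inv_fst (tau0 : R * R) : fst tau0 <> 0 ->
  filterlim (fun tau : R * R => / fst tau) (locally tau0) (locally (/ fst tau0)).
Proof.
  intros H. apply filterlim_inv; [typeclasses eauto|exact H|]. apply continuous_fst.
Qed.

(** Near tau0 the equation e(1 / rho, sigma) = eps / rho has a solution sigma close to
    sigma0; injectivity of e in sigma identifies it with the second component of
    [Phi_inv], which is chosen in S without regard to nearness. *)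
Lemma Phi_inv_continuous : continuous_on (S_tau e S) (Phi_inv e S).
Proof.
  intros tau0 H0. pose proof (S_tau_rho_pos _ H0) as Hr0.
  destruct (Phi_inv_spec tau0 H0) as [HS0 _].
  pose proof (Phi_inv_fst tau0 H0) as E1. pose proof (energy_Phi_inv tau0 H0) as E2.
  apply filterlim_locally. intros eps.
  destruct (Phi_inv e S tau0) as [nu0 sigma0]. simpl in E1, E2.
  destruct (open_box S nu0 sigma0 (regime_open _ _ _ HS) HS0) as [d Hd].
  assert (Hk : 0 < Rmin eps d) by (apply Rmin_pos; apply cond_pos).
  destruct (local_solution e nu0 sigma0 _ Hk) as [r Hr].
  { exists d. intros u v Hu Hv. apply energy_increasing. auto. }
  assert (Hm : 0 < Rmin r (Rmin eps d)) by (repeat apply Rmin_pos; apply cond_pos).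
  pose proof (filterlim_inv_fst tau0 ltac:(lra)) as L1.
  pose proof (filterlim_mul (locally tau0) _ _ _ _ _ (continuous_snd (fst tau0) (snd tau0)) L1)
    as L2.
  unfold within. generalize (filter_and _ _
    (proj1 (filterlim_locally _ _) L1 (mkposreal _ Hm))
    (proj1 (filterlim_locally _ _) L2 (mkposreal _ Hm))).
  apply filter_imp. intros tau [B1 B2] Ht.
  assert (B1' : Rabs (/ fst tau - nu0) < Rmin r (Rmin eps d)) by (rewrite E1; exact B1).
  assert (B2' : Rabs (snd tau * / fst tau - e nu0 sigma0) < Rmin r (Rmin eps d))
    by (rewrite E2; exact B2).
  pose proof (Rmin_l r (Rmin eps d)). pose proof (Rmin_r r (Rmin eps d)).
  pose proof (Rmin_l eps d). pose proof (Rmin_r eps d).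
  destruct (Hr (/ fst tau) (snd tau * / fst tau) ltac:(lra) ltac:(lra)) as (sigma & Hs & E).
  destruct (Phi_inv_spec tau Ht) as [HSt _].
  pose proof (Phi_inv_fst tau Ht) as F1. pose proof (energy_Phi_inv tau Ht) as F2.
  destruct (Phi_inv e S tau) as [nu sigma']. simpl in F1, F2. subst nu.
  assert (sigma' = sigma) as ->.
  { apply (regime_injective _ _ _ HS (/ fst tau)); trivial;
      [|exact (eq_trans F2 (eq_sym E))].
    apply Hd; lra. }
  split.
  - change (Rabs (/ fst tau - nu0) < eps). lra.
  - change (Rabs (sigma - sigma0) < eps). lra.
Qed.

(** * Isobars *)

(** The derivative of nu with respect to sigma along a level set of e_nu. *)
Definition isobar_slope (nu sigma : R) : R := - e_nu_sigma nu sigma / e_nu_nu nu sigma.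

(** The image of (isobar_slope, 1) under the differential of [Phi]. *)
Definition isobar_direction (nu sigma : R) : R * R :=
  let k := isobar_slope nu sigma in
  (- k / nu ^ 2, (e_nu nu sigma * k + e_sigma nu sigma) / nu - e nu sigma * k / nu ^ 2).

Lemma energy_nu_nu_pos nu sigma : S (nu, sigma) -> 0 < e_nu_nu nu sigma.
Proof. intros H. exact (proj1 (regime_convex _ _ _ HS nu sigma H)). Qed.

(** If the density component vanishes then so does the slope, and the energy component
    reduces to the temperature divided by nu. *)
Lemma isobar_direction_neq_0 nu sigma : S (nu, sigma) -> isobar_direction nu sigma <> (0, 0).
Proof.
  intros H E. pose proof (regime_nu_pos _ _ H) as Hn.
  pose proof (regime_temperature_pos _ _ _ HS nu sigma H) as HT.
  change (0 < e_sigma nu sigma) in HT.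
  unfold isobar_direction in E. set (k := isobar_slope nu sigma) in *.
  pose proof (f_equal fst E : - k / nu ^ 2 = 0) as E1.
  pose proof (f_equal snd E : _ / nu - _ * k / nu ^ 2 = 0) as E2.
  assert (k = 0) as Hk.
  { replace k with (- (- k / nu ^ 2) * nu ^ 2) by (field; lra). rewrite E1. ring. }
  rewrite Hk in E2.
  assert (0 < e_sigma nu sigma / nu) by (apply Rdiv_lt_0_compat; trivial).
  cbv beta in *.
  unfold Rdiv in *. lra.
Qed.

Lemma isobar_direction_continuous (g : R -> R) s :
  S (g s, s) -> continuous g s -> continuous (fun s => isobar_direction (g s) s) s.
Proof.
  intros H Hg. pose proof (regime_nu_pos _ _ H) as Hn.
  pose proof (energy_nu_nu_pos _ _ H) as Hnn.
  destruct (energy_C1 _ _ H) as (C0 & _ & _ & [C1 _] & [C2 _]).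
  destruct (energy_nu_C1 _ _ H) as (_ & _ & _ & [C11 _] & [C12 _]).
  assert (Fs : Filter (locally s)) by typeclasses eauto.
  assert (Hc : forall A, continuity_2d_pt A (g s) s ->
             filterlim (fun s => A (g s) s) (locally s) (locally (A (g s) s))).
  { intros A HA. apply filterlim_comp_2d; trivial. apply filterlim_id. }
  assert (Hi : filterlim (fun s => / g s) (locally s) (locally (/ g s)))
    by (apply filterlim_inv; trivial; lra).
  assert (Hi2 : filterlim (fun s => / g s ^ 2) (locally s) (locally (/ g s ^ 2))).
  { apply filterlim_inv; trivial; [apply pow_nonzero; lra|].
    repeat apply filterlim_mul; trivial. apply filterlim_const. }
  assert (Hk : filterlim (fun s => isobar_slope (g s) s) (locally s)
                 (locally (isobar_slope (g s) s))).
  { unfold isobar_slope, Rdiv.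
    apply filterlim_mul; trivial.
    - exact (filterlim_comp _ _ _ _ _ _ _ _ (Hc e_nu_sigma C12)
               (filterlim_opp (V := R_NormedModule) _)).
    - apply filterlim_inv; trivial; [now apply Rgt_not_eq|exact (Hc e_nu_nu C11)]. }
  apply filterlim_locally_pair; trivial.
  - apply filterlim_mul; trivial.
    exact (filterlim_comp _ _ _ _ _ _ _ _ Hk (filterlim_opp (V := R_NormedModule) _)).
  - apply filterlim_add; trivial.
    + apply filterlim_mul; trivial. apply filterlim_add; trivial; [|exact (Hc _ C2)].
      apply filterlim_mul; trivial. exact (Hc _ C1).
    + refine (filterlim_comp _ _ _ _ _ _ _ _ _ (filterlim_opp (V := R_NormedModule) _)).
      apply filterlim_mul; trivial. apply filterlim_mul; trivial. exact (Hc _ C0).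
Qed.

Lemma Phi_curve_derive (g : R -> R) s :
  S (g s, s) -> is_derive g s (isobar_slope (g s) s) ->
  is_derive (fun s => Phi e (g s, s)) s (isobar_direction (g s) s).
Proof.
  intros H Hg. pose proof (regime_nu_pos _ _ H) as Hn.
  unfold Phi, isobar_direction. simpl fst; simpl snd.
  set (k := isobar_slope (g s) s) in *.
  assert (He : is_derive (fun s => e (g s) s) s (e_nu (g s) s * k + e_sigma (g s) s)).
  { replace (_ + _) with (e_nu (g s) s * k + e_sigma (g s) s * 1) by ring.
    apply is_derive_Reals. apply derivable_pt_lim_comp_2d.
    - apply (differentiable_of_C1 e S); trivial; [apply HS|apply energy_C1].
    - now apply is_derive_Reals.
    - apply derivable_pt_lim_id. }
  apply is_derive_pair.
  - evar_last; [apply is_derive_div; [apply is_derive_const|exact Hg|lra]|].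
    unfold zero; simpl. field. lra.
  - evar_last; [apply is_derive_div; [exact He|exact Hg|lra]|]. cbv beta. field. lra.
Qed.

(** The implicit function theorem for e_nu gives the curve s |-> Phi (g s, s).  That it
    exhausts the isobar near its base point needs the continuity of [Phi_inv]: nearby
    points of the isobar must come from nearby (nu, sigma), where solutions of
    e_nu = - P are unique. *)
Lemma isobar_regular_parameterization nu0 sigma0 :
  S (nu0, sigma0) ->
  exists a b phi dphi,
    regular_parameterization (isobar e S (p_hat e nu0 sigma0)) a b phi dphi sigma0 /\
    phi sigma0 = Phi e (nu0, sigma0) /\ dphi sigma0 = isobar_direction nu0 sigma0.
Proof.
  intros H0.
  set (F := fun s u => e_nu u s).
  destruct (implicit_function F (fun s u => S (u, s)) sigma0 nu0) as (r & d & g & G0 & G1 & G2).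
  { apply locally_2d_swap with (Q := fun u s => increasing_at F s u /\ S (u, s)).
    destruct (open_box S nu0 sigma0 (regime_open _ _ _ HS) H0) as [r Hr].
    exists r. intros u s Hu Hs. specialize (Hr u s Hu Hs). split; trivial.
    now apply energy_nu_increasing. }
  pose proof (cond_pos r) as Hr.
  assert (Hab : forall s, sigma0 - r < s < sigma0 + r <-> Rabs (s - sigma0) < r).
  { intros s. split; intros Hs; [apply Rabs_def1; lra|apply Rabs_def2 in Hs; lra]. }
  assert (Hder : forall s, Rabs (s - sigma0) < r -> is_derive g s (isobar_slope (g s) s)).
  { intros s Hs. destruct (G1 s Hs) as (E & _ & HSs & Cg).
    set (J := fun s => Rabs (s - sigma0) < r).
    apply (is_derive_of_slope_limit J).
    - assert (Hd : 0 < r - Rabs (s - sigma0)) by lra.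
      exists (mkposreal _ Hd). intros z Hz. unfold J.
      change (Rabs (z - s) < r - Rabs (s - sigma0)) in Hz.
      pose proof (Rabs_triang (z - s) (s - sigma0)) as T.
      replace (z - s + (s - sigma0)) with (z - sigma0) in T by ring. lra.
    - evar_last; [apply (slope_limit_implicit J F (fun s => s) g s
        (e_nu_sigma (g s) s) (e_nu_nu (g s) s) 1 0)|].
      + apply Rgt_not_eq. now apply energy_nu_nu_pos.
      + apply (differentiable_swap e_nu).
        apply (differentiable_of_C1 e_nu S); trivial; [apply HS|apply energy_nu_C1].
      + apply slope_limit_id.
      + intros Q HQ. specialize (Cg Q HQ). unfold filtermap, punctured, within in *.
        revert Cg. apply filter_imp. tauto.
      + apply slope_limit_ext with (fun _ => F sigma0 nu0); trivial.
        * intros z Hz. symmetry. now apply G1.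
        * apply slope_limit_const.
      + unfold isobar_slope. cbv beta. field.
        apply Rgt_not_eq. now apply energy_nu_nu_pos. }
  exists (Finite (sigma0 - r)), (Finite (sigma0 + r)), (fun s => Phi e (g s, s)),
    (fun s => isobar_direction (g s) s).
  rewrite G0. refine (conj _ (conj eq_refl eq_refl)).
  refine (conj _ (conj _ (conj _ _))); simpl; [lra|lra| |].
  - intros s H1 H2.
    destruct (G1 s ltac:(now apply Hab)) as (E & _ & HSs & Cg).
    refine (conj (conj _ _) (conj _ (conj _ _))).
    + now exists (g s, s).
    + unfold pressure. rewrite Phi_inv_Phi by trivial. simpl.
      unfold p_hat. f_equal. exact E.
    + apply Phi_curve_derive; trivial. apply Hder. now apply Hab.
    + now apply isobar_direction_continuous.
    + now apply isobar_direction_neq_0.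
  - assert (Ht : S_tau e S (Phi e (nu0, sigma0))) by now exists (nu0, sigma0).
    assert (Hm : 0 < Rmin r d) by (apply Rmin_pos; apply cond_pos).
    pose proof (proj1 (filterlim_locally _ _) (Phi_inv_continuous _ Ht) (mkposreal _ Hm)) as L.
    rewrite Phi_inv_Phi in L by trivial.
    unfold within in L. rewrite G0. revert L. apply filter_imp. intros tau L [H1 H2].
    specialize (L H1). destruct (Phi_inv_spec tau H1) as [HSt HPt].
    unfold pressure in H2.
    destruct (Phi_inv e S tau) as [nu sigma]. simpl in H2. destruct L as [L1 L2].
    change (Rabs (nu - nu0) < Rmin r d) in L1.
    change (Rabs (sigma - sigma0) < Rmin r d) in L2.
    pose proof (Rmin_l r d). pose proof (Rmin_r r d).
    exists sigma.
    assert (nu = g sigma) as <-.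
    { apply G2; [lra|lra|]. apply Ropp_eq_reg. exact H2. }
    assert (sigma0 - r < sigma < sigma0 + r) by (apply Hab; lra).
    repeat split; trivial; lra.
Qed.

(** Two relations determine the velocity (nu', sigma') of the path in the coordinates
    (nu, sigma): one from the energy, whose slope is known, and one from the vanishing
    slope of the pressure. *)
Lemma isobaric_velocity_tangent J t (tau : R -> R * R) rho' eps' :
  J t -> (forall d : posreal, exists s, J s /\ s <> t /\ Rabs (s - t) < d) ->
  (forall s, J s -> S_tau e S (tau s)) ->
  slope_limit J (fun s => fst (tau s)) t rho' ->
  slope_limit J (fun s => snd (tau s)) t eps' ->
  slope_limit J (fun s => pressure e S (tau s)) t 0 ->
  tangent_space (isobar e S (pressure e S (tau t))) (tau t) (rho', eps').
Proof.
  intros Ht Hlim Hin Hrho Heps Hp.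
  set (nu := fun s => fst (Phi_inv e S (tau s))).
  set (sigma := fun s => snd (Phi_inv e S (tau s))).
  destruct (Phi_inv_spec (tau t) (Hin t Ht)) as [HSt HPt].
  assert (HSt' : S (nu t, sigma t)).
  { unfold nu, sigma. now rewrite <- surjective_pairing. }
  pose proof (regime_nu_pos _ _ HSt') as Hnu.
  pose proof (energy_nu_nu_pos _ _ HSt') as Hnn.
  pose proof (regime_temperature_pos _ _ _ HS _ _ HSt') as HT.
  change (0 < e_sigma (nu t) (sigma t)) in HT. cbv beta in Hnn, HT.
  assert (EP : Phi e (nu t, sigma t) = tau t).
  { unfold nu, sigma. now rewrite <- surjective_pairing. }
  assert (Er : / nu t = fst (tau t)) by (rewrite <- EP; simpl; field; lra).
  assert (Ee : e (nu t) (sigma t) / nu t = snd (tau t)) by (rewrite <- EP; reflexivity).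
  assert (Hr : 0 < fst (tau t)) by (rewrite <- Er; now apply Rinv_0_lt_compat).
  assert (Lnu : slope_limit J nu t (- nu t ^ 2 * rho')).
  { apply slope_limit_ext with (fun s => / fst (tau s)); trivial.
    - intros s Hs. symmetry. now apply Phi_inv_fst, Hin.
    - apply (slope_limit_comp_1 J Rinv); trivial.
      evar_last; [apply is_derive_inv; [apply is_derive_id|lra]|].
      unfold one; simpl. rewrite <- Er. field. lra. }
  assert (Le : slope_limit J (fun s => e (nu s) (sigma s)) t
                 (nu t * eps' + e (nu t) (sigma t) / nu t * (- nu t ^ 2 * rho'))).
  { rewrite Ee. apply slope_limit_ext with (fun s => snd (tau s) * nu s); trivial.
    - intros s Hs. unfold nu, sigma. rewrite energy_Phi_inv by auto.
      now rewrite Phi_inv_fst by auto.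
    - now apply (slope_limit_mult J (fun s => snd (tau s)) nu). }
  (* Continuity of sigma comes from that of Phi_inv; it is what makes implicit
     differentiation of the energy relation possible. *)
  assert (Csigma : filterlim sigma (punctured J t) (locally (sigma t))).
  { pose proof (filterlim_locally_pair _ _ _ _ _ _ (slope_limit_continuous _ _ _ _ Hrho)
      (slope_limit_continuous _ _ _ _ Heps)) as Ct.
    unfold sigma.
    refine (filterlim_comp _ _ _ (fun s => Phi_inv e S (tau s)) snd _
              (locally (Phi_inv e S (tau t))) _ _ (continuous_snd (fst (Phi_inv e S (tau t))) (snd (Phi_inv e S (tau t))))).
    refine (filterlim_comp _ _ _ tau (Phi_inv e S) _ _ _ _ (Phi_inv_continuous _ (Hin t Ht))).
    intros Q HQ. unfold within in HQ.
    assert (HQ' : locally (fst (tau t), snd (tau t)) (fun x => S_tau e S x -> Q x)).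
    { now rewrite <- surjective_pairing. }
    specialize (Ct _ HQ'). unfold filtermap in *.
    generalize (filter_and _ _ (punctured_domain J t) Ct). apply filter_imp.
    intros s [[Hs _] H]. rewrite <- surjective_pairing in H. auto. }
  pose proof (slope_limit_implicit J e nu sigma t _ _ _ _ (Rgt_not_eq _ _ HT)
    (differentiable_of_C1 e S _ _ (regime_open _ _ _ HS) energy_C1 HSt')
    Lnu Csigma Le) as Lsigma.
  set (sigma' := (_ - _) / _) in Lsigma.
  pose proof (slope_limit_comp J e_nu nu sigma t _ _ _ _
    (differentiable_of_C1 e_nu S _ _ (regime_open _ _ _ HS) energy_nu_C1 HSt')
    Lnu Lsigma) as Lp.
  assert (E0 : e_nu_nu (nu t) (sigma t) * (- nu t ^ 2 * rho')
               + e_nu_sigma (nu t) (sigma t) * sigma' = 0).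
  { apply (slope_limit_unique J t (fun s => e_nu (nu s) (sigma s))); trivial.
    apply slope_limit_ext with (fun s => 0 - pressure e S (tau s)); trivial.
    - intros s _. unfold pressure, p_hat. fold (nu s) (sigma s).
      change (partial_derive 1 0 e (nu s) (sigma s)) with (e_nu (nu s) (sigma s)).
      cbv beta. ring.
    - pose proof (slope_limit_minus J _ _ t _ _ (slope_limit_const J 0 t) Hp) as M.
      now rewrite (Rminus_0_r 0) in M. }
  destruct (isobar_regular_parameterization _ _ HSt') as (a & b & phi & dphi & H1 & H2 & H3).
  exists a, b, phi, dphi, (sigma t). refine (conj H1 (conj (eq_trans H2 EP) _)).
  exists sigma'. rewrite H3.
  assert (Es : e_sigma (nu t) (sigma t) * sigma'
     = nu t * eps' + e (nu t) (sigma t) / nu t * (- nu t ^ 2 * rho')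
       - e_nu (nu t) (sigma t) * (- nu t ^ 2 * rho')).
  { unfold sigma'. cbv beta. field. split; lra. }
  destruct (tangent_components _ _ _ _ _ _ _ _ _ Hnu Hnn E0 Es) as [C1 C2].
  exact (f_equal2 pair C1 C2).
Qed.
End Regime.

(** * Schemes *)

Lemma tangent_space_scal G tau w c : tangent_space G tau w -> tangent_space G tau (scal c w).
Proof.
  intros (a & b & phi & dphi & t & H1 & H2 & k & ->).
  exists a, b, phi, dphi, t. refine (conj H1 (conj H2 _)).
  exists (c * k). now rewrite scal_assoc.
Qed.

Lemma balance_residual (h : R) (A D : R3) :
  plus (scal h A) D = zero -> D = scal (- h) A.
Proof.
  destruct A as [[a1 a2] a3], D as [[d1 d2] d3]. intros E.
  pose proof (f_equal (fun X => fst (fst X)) E : h * a1 + d1 = 0) as E1.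
  pose proof (f_equal (fun X => snd (fst X)) E : h * a2 + d2 = 0) as E2.
  pose proof (f_equal snd E : h * a3 + d3 = 0) as E3.
  change ((d1, d2, d3) = (- h * a1, - h * a2, - h * a3)).
  repeat f_equal; lra.
Qed.

(** The differential of [tau_of] at a state of velocity v. *)
Definition dtau_of (v : R) (D : R3) : R * R :=
  (fst (fst D), snd D - v * snd (fst D) + v ^ 2 / 2 * fst (fst D)).

Lemma dtau_of_minus v D1 D2 : dtau_of v (minus D1 D2) = minus (dtau_of v D1) (dtau_of v D2).
Proof.
  destruct D1 as [[a1 b1] c1], D2 as [[a2 b2] c2].
  unfold dtau_of, minus, plus, opp; simpl. unfold prod_plus, prod_opp, plus, opp; simpl.
  unfold prod_plus, prod_opp, plus, opp; simpl.
  f_equal; ring.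
Qed.

Lemma dtau_of_scal v c D : dtau_of v (scal c D) = scal c (dtau_of v D).
Proof.
  destruct D as [[a1 b1] c1].
  unfold dtau_of, scal; simpl. unfold prod_scal, scal; simpl.
  unfold prod_scal, scal, mult; simpl. unfold mult; simpl. f_equal; ring.
Qed.

Lemma tau_of_Theta tau v : 0 < fst tau -> tau_of (Theta tau v) = tau.
Proof. destruct tau as [rho eps]; simpl. intros H. f_equal. field. lra. Qed.

Lemma velocity_Theta tau v : 0 < fst tau -> velocity (Theta tau v) = v.
Proof. destruct tau as [rho eps]; simpl. intros H. field. lra. Qed.

Lemma tau_of_slope J (U : R -> R3) t dU :
  is_derive_within J U t dU -> fst (tau_of (U t)) <> 0 ->
  slope_limit J (fun s => fst (tau_of (U s))) t (fst (dtau_of (velocity (U t)) dU)) /\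
  slope_limit J (fun s => snd (tau_of (U s))) t (snd (dtau_of (velocity (U t)) dU)).
Proof.
  intros HU H0.
  assert (Hrho : slope_limit J (fun s => fst (fst (U s))) t (fst (fst dU))).
  { apply slope_limit_of_is_derive_within.
    apply (is_derive_within_linear (fun D : R3 => fst (fst D))); trivial.
    apply (is_linear_comp (fun D : R3 => fst D) (fun D : R * R => fst D)); apply is_linear_fst. }
  assert (Hm : slope_limit J (fun s => snd (fst (U s))) t (snd (fst dU))).
  { apply slope_limit_of_is_derive_within.
    apply (is_derive_within_linear (fun D : R3 => snd (fst D))); trivial.
    apply (is_linear_comp (fun D : R3 => fst D) (fun D : R * R => snd D));
      [apply is_linear_fst|apply is_linear_snd]. }
  assert (HE : slope_limit J (fun s => snd (U s)) t (snd dU)).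
  { apply slope_limit_of_is_derive_within.
    apply (is_derive_within_linear (fun D : R3 => snd D)); trivial. apply is_linear_snd. }
  assert (H0' : fst (fst (U t)) <> 0) by (revert H0; now destruct (U t) as [[rho m] E]).
  assert (Hi : slope_limit J (fun s => / fst (fst (U s))) t
                 (- / fst (fst (U t)) ^ 2 * fst (fst dU))).
  { apply (slope_limit_comp_1 J Rinv (fun s => fst (fst (U s)))); trivial.
    evar_last; [apply is_derive_inv; [apply is_derive_id|exact H0']|].
    unfold one; simpl. field. trivial. }
  pose proof (slope_limit_minus J _ _ t _ _ HE
    (slope_limit_mult J _ _ t _ _ (slope_limit_const J (/ 2) t)
       (slope_limit_mult J _ _ t _ _ (slope_limit_mult J _ _ t _ _ Hm Hm) Hi))) as Heps.
  split.
  - eapply filterlim_ext; [|exact Hrho].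
    intros s. cbv beta. now destruct (U s) as [[rho m] E], (U t) as [[rho0 m0] E0].
  - cbv beta in Heps.
    replace (snd (dtau_of _ _)) with
      (snd dU - (snd (fst (U t)) * snd (fst (U t)) * / fst (fst (U t)) * 0
        + / 2 * (/ fst (fst (U t)) * (snd (fst (U t)) * snd (fst dU) + snd (fst (U t)) * snd (fst dU))
        + snd (fst (U t)) * snd (fst (U t)) * (- / fst (fst (U t)) ^ 2 * fst (fst dU))))).
    + eapply filterlim_ext; [|exact Heps].
      intros s. cbv beta.
      destruct (U s) as [[rho m] E], (U t) as [[rho0 m0] E0]. simpl. unfold Rdiv. ring.
    + destruct (U t) as [[rho0 m0] E0]. simpl in *. field. trivial.
Qed.

Section Scheme.
Context {smin : R} {e : R -> R -> R} {S : R * R -> Prop}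
  (HS : admissible_regime smin e S).

Lemma Theta_M_PV P V tau : isobar e S P tau -> M_PV e S P V (Theta tau V).
Proof.
  intros [H1 H2]. pose proof (S_tau_rho_pos HS _ H1) as Hr.
  unfold M_PV. rewrite tau_of_Theta, velocity_Theta by trivial.
  repeat split; trivial. now exists tau, V.
Qed.

(** Mass, momentum and energy fluxes enter with the weights V^2 / 2, - V and 1, so the
    pressure contributes - V p + V p = 0. *)
Lemma dtau_of_flux V tau : S_tau e S tau ->
  dtau_of V (euler_flux e S (Theta tau V)) = scal V tau.
Proof.
  intros H. pose proof (S_tau_rho_pos HS _ H) as Hr.
  destruct tau as [rho eps]. unfold Theta, euler_flux.
  change (rho, rho * V, eps + / 2 * rho * V ^ 2) with (Theta (rho, eps) V).
  rewrite velocity_Theta, tau_of_Theta by trivial.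
  unfold dtau_of, scal; simpl. unfold prod_scal, scal; simpl. unfold mult; simpl.
  f_equal; field.
Qed.

(** Put the three states in cells 0, 1, 2 and the third one in all further cells: the
    equation of cell 1 at the initial time identifies the flux difference with - h times
    the rate of change of the central state, whose pressure is stationary. *)
Lemma flux_difference_tangent n h fh P V tauL tauC tauR :
  (1 <= n)%nat -> 0 < h ->
  numerical_scheme e S n h fh -> pressure_equilibrium_preserving e S n h fh ->
  0 < P -> isobar e S P tauL -> isobar e S P tauC -> isobar e S P tauR ->
  tangent_space (isobar e S P) tauC
    (dtau_of V (minus (fh (Theta tauR V) (Theta tauC V)) (fh (Theta tauC V) (Theta tauL V)))).
Proof.
  intros Hn Hh Hscheme Hpep HP HL HC HR.
  set (u0 := fun i => match i with
                      | O => Theta tauL V | 1%nat => Theta tauC V | _ => Theta tauR V end).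
  assert (Hu0 : admissible_grid_state e S n u0).
  { intros [|[|i]] _; eexists _, V; split; try reflexivity; [apply HL|apply HC|apply HR]. }
  destruct (Hscheme u0 Hu0) as (J & U & HJ & Hsol).
  destruct HJ as (J0 & Jpos & (t1 & Ht1 & Jt1) & Jconv).
  assert (HJ : time_interval J) by (repeat split; trivial; now exists t1).
  pose proof Hsol as (Hinit & Hadm & dU & HdU & Hode).
  assert (Hi1 : interior_cell n 1) by (unfold interior_cell; lia).
  assert (UL : U 0%nat 0 = Theta tauL V) by (apply Hinit; lia).
  assert (UC : U 1%nat 0 = Theta tauC V) by (apply Hinit; lia).
  assert (UR : U 2%nat 0 = Theta tauR V) by (apply Hinit; lia).
  destruct (Hpep u0 J U Hu0 HJ Hsol 0 1%nat P V J0 Hi1 HP) as [Hp _]; simpl.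
  { rewrite UR. now apply Theta_M_PV. }
  { rewrite UC. now apply Theta_M_PV. }
  { rewrite UL. now apply Theta_M_PV. }
  specialize (Hode 1%nat 0 Hi1 J0). simpl in Hode. rewrite UL, UC, UR in Hode.
  set (D := minus (fh (Theta tauR V) (Theta tauC V)) (fh (Theta tauC V) (Theta tauL V))) in *.
  destruct (HdU 1%nat ltac:(lia)) as [HdC _]. specialize (HdC 0 J0).
  pose proof (S_tau_rho_pos HS _ (proj1 HC)) as Hr.
  assert (EtC : tau_of (U 1%nat 0) = tauC) by (rewrite UC; now apply tau_of_Theta).
  destruct (tau_of_slope J (U 1%nat) 0 _ HdC) as [S1 S2]; [rewrite EtC; lra|].
  rewrite UC, velocity_Theta in S1, S2 by trivial.
  rewrite (balance_residual h _ D Hode), dtau_of_scal.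
  apply tangent_space_scal.
  rewrite (surjective_pairing (dtau_of _ _)).
  rewrite <- (proj2 HC), <- EtC.
  apply (isobaric_velocity_tangent HS J 0 (fun s => tau_of (U 1%nat s))); trivial.
  - intros d. exists (Rmin (d / 2) t1). pose proof (cond_pos d).
    pose proof (Rmin_l (d / 2) t1). pose proof (Rmin_r (d / 2) t1).
    assert (0 < Rmin (d / 2) t1) by (apply Rmin_pos; lra).
    split; [apply (Jconv _ t1); [trivial|lra]|]. split; [lra|].
    apply Rabs_def1; lra.
  - intros s Hs. destruct (Hadm s Hs 1%nat ltac:(lia)) as (tau & v & Htau & E).
    rewrite <- E, tau_of_Theta; trivial. now apply (S_tau_rho_pos HS).
  - now apply slope_limit_of_is_derive_within.
Qed.
End Scheme.

Theorem corollary1 (smin : R) (e : R -> R -> R)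
    (He : equation_of_state smin e)
    (S_eta : R * R -> Prop) (HS : admissible_regime smin e S_eta) :
  (exists (n : nat) (h : R) (fh : R3 -> R3 -> R3),
      (1 <= n)%nat /\ 0 < h /\
      consistent e S_eta fh /\
      numerical_scheme e S_eta n h fh /\
      pressure_equilibrium_preserving e S_eta n h fh) ->
  forall P : R, 0 < P -> (exists tau, isobar e S_eta P tau) ->
  forall tau1 tau2 : R * R,
    isobar e S_eta P tau1 -> isobar e S_eta P tau2 ->
    exists x : R * R,
      tangent_line (isobar e S_eta P) tau1 x /\
      tangent_line (isobar e S_eta P) tau2 x.
Proof.
  intros (n & h & fh & Hn & Hh & Hcons & Hscheme & Hpep) P HP _ tau1 tau2 H1 H2.
  assert (Hflux : forall tau, isobar e S_eta P tau ->
            dtau_of 1 (fh (Theta tau 1) (Theta tau 1)) = tau).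
  { intros tau [Htau _]. rewrite Hcons by now exists tau, 1.
    rewrite (dtau_of_flux HS) by trivial. exact (scal_one tau). }
  exists (dtau_of 1 (fh (Theta tau1 1) (Theta tau2 1))). split.
  - pose proof (flux_difference_tangent HS n h fh P 1 tau2 tau1 tau1 Hn Hh Hscheme Hpep
                  HP H2 H1 H1) as T.
    apply (tangent_space_scal _ _ _ (-1)) in T.
    rewrite dtau_of_minus, (Hflux tau1 H1) in T.
    eexists; split; [exact T|].
    destruct (dtau_of 1 (fh (Theta tau1 1) (Theta tau2 1))) as [x1 x2], tau1 as [r1 e1].
    change ((x1, x2) = (r1 + -1 * (r1 - x1), e1 + -1 * (e1 - x2))). f_equal; ring.
  - pose proof (flux_difference_tangent HS n h fh P 1 tau2 tau2 tau1 Hn Hh Hscheme Hpep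
                  HP H2 H2 H1) as T.
    rewrite dtau_of_minus, (Hflux tau2 H2) in T.
    eexists; split; [exact T|].
    destruct (dtau_of 1 (fh (Theta tau1 1) (Theta tau2 1))) as [x1 x2], tau2 as [r2 e2].
    change ((x1, x2) = (r2 + (x1 - r2), e2 + (x2 - e2))). f_equal; ring.
Qed.
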